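(* Let $\Gamma$, $\varphi$, $\Xi$, $(\cdot)^\flat$ and $\mathscr{M}$ be as in the context. For every base $\mathscr{B}\supseteq\mathscr{M}$ and finite multiset of atoms $S$: (1) if $\sigma\multimap\tau\in\Xi$, then $S\vdash_{\mathscr{B}}(\sigma\multimap\tau)^\flat$ iff $S,\sigma^\flat\vdash_{\mathscr{B}}\tau^\flat$; (2) if $\sigma\otimes\tau\in\Xi$, then $S\vdash_{\mathscr{B}}(\sigma\otimes\tau)^\flat$ iff for every $\mathscr{Y}\supseteq\mathscr{B}$, finite multiset of atoms $V$ and atom $p$, if $V,\sigma^\flat,\tau^\flat\vdash_{\mathscr{Y}}p$ then $S,V\vdash_{\mathscr{Y}}p$; (3) if $\mathrm{I}\in\Xi$, then $S\vdash_{\mathscr{B}}\mathrm{I}^\flat$ iff for every $\mathscr{Y}\supseteq\mathscr{B}$, $V$ and atom $p$, if $V\vdash_{\mathscr{Y}}p$ then $S,V\vdash_{\mathscr{Y}}p$.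
   Context: Fix a countably infinite set $\mathbb{A}$ of atoms. IMLL formulas: $\varphi::= p\in\mathbb{A}\mid\varphi\otimes\varphi\mid \mathrm{I}\mid\varphi\multimap\varphi$; multisets are finite, ''$,$'' is multiset union. An atomic rule is $(P_1\triangleright p_1,\dots,P_n\triangleright p_n)\Rightarrow p$ ($n\ge0$, $P_i$ finite multisets of atoms, $\triangleright p$ abbreviating $\emptyset\triangleright p$); a base is a set of atomic rules. Derivability $\vdash_{\mathscr{B}}$ is the least relation with (Ref) $[p]\vdash_{\mathscr{B}}p$; (App) if $(P_1\triangleright p_1,\dots,P_n\triangleright p_n)\Rightarrow p\in\mathscr{B}$ and $S_i,P_i\vdash_{\mathscr{B}}p_i$ for all $i$, then $S_1,\dots,S_n\vdash_{\mathscr{B}}p$. Fix a finite multiset $\Gamma$ and formula $\varphi$; let $\Xi$ be the set of all subformulas of formulas in $\Gamma$ and of $\varphi$. Let $(\cdot)^\flat:\Xi\to\mathbb{A}$ be an injection with $p^\flat=p$ for atoms $p\in\Xi$ and such that, for non-atomic $\xi$, $\xi^\flat$ is an atom not occurring in $\Xi$. The base $\mathscr{M}$ consists of the rules: for each $\sigma\multimap\tau\in\Xi$, $(\sigma^\flat\triangleright\tau^\flat)\Rightarrow(\sigma\multimap\tau)^\flat$ and $(\triangleright(\sigma\multimap\tau)^\flat,\triangleright\sigma^\flat)\Rightarrow\tau^\flat$; for each $\sigma\otimes\tau\in\Xi$, $(\triangleright\sigma^\flat,\triangleright\tau^\flat)\Rightarrow(\sigma\otimes\tau)^\flat$ and,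 for every atom $p$, $(\triangleright(\sigma\otimes\tau)^\flat,\ \sigma^\flat,\tau^\flat\triangleright p)\Rightarrow p$; if $\mathrm{I}\in\Xi$, the rule $\Rightarrow\mathrm{I}^\flat$ and, for every atom $p$, $(\triangleright\mathrm{I}^\flat,\triangleright p)\Rightarrow p$. *)

(* Defs.v *)
(* MathComp (boot) world: finite multisets of atoms are represented by
   sequences; derivability is closed under permutation (perm_eq) by
   construction, so it only depends on the underlying multisets. *)
From mathcomp Require Import all_boot.
Set Implicit Arguments. Unset Strict Implicit. Unset Printing Implicit Defensive.

Definition atom := nat.

Inductive formula : Type :=
| Atom of atom
| Tensor of formula & formula
| One
| Lolli of formula & formula.

Definition amset := seq atom.

(* An atomic rule (P_1 |> p_1, ..., P_n |> p_n) => p. *)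
Definition rule := (seq (amset * atom) * atom)%type.

Definition base := rule -> Prop.

Definition subbase (B C : base) : Prop := forall r, B r -> C r.

(* Derivability S |-_B p : least relation closed under (Ref) and (App);
   the context of (App) is S_1,...,S_n up to multiset equality. *)
Inductive deriv (B : base) : amset -> atom -> Prop :=
| deriv_Ref p : deriv B [:: p] p
| deriv_App (prem : seq (amset * atom)) (p : atom) (Ss : seq amset) (S : amset) :
    B (prem, p) ->
    size Ss = size prem ->
    (forall i, i < size prem ->
       deriv B (nth [::] Ss i ++ (nth ([::], 0) prem i).1) (nth ([::], 0) prem i).2) ->
    perm_eq S (flatten Ss) ->
    deriv B S p.

(* Membership in a list (formulas need not be an eqType). *)
Fixpoint inlist (x : formula) (l : seq formula) : Prop :=
  if l is y :: l' then y = x \/ inlist x l' else False.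

Inductive subform : formula -> formula -> Prop :=
| sub_refl f : subform f f
| sub_tensorl f a b : subform f a -> subform f (Tensor a b)
| sub_tensorr f a b : subform f b -> subform f (Tensor a b)
| sub_lollil f a b : subform f a -> subform f (Lolli a b)
| sub_lollir f a b : subform f b -> subform f (Lolli a b).

Definition inXi (Gamma : seq formula) (phi xi : formula) : Prop :=
  exists psi, (inlist psi Gamma \/ psi = phi) /\ subform xi psi.

Definition is_atomic (f : formula) : Prop :=
  match f with Atom _ => True | _ => False end.

Definition flat_ok (Gamma : seq formula) (phi : formula) (flat : formula -> atom) : Prop :=
  (forall x y, inXi Gamma phi x -> inXi Gamma phi y -> flat x = flat y -> x = y) /\
  (forall p, inXi Gamma phi (Atom p) -> flat (Atom p) = p) /\
  (forall x, inXi Gamma phi x -> ~ is_atomic x -> ~ inXi Gamma phi (Atom (flat x))).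

Definition Mbase (Gamma : seq formula) (phi : formula) (flat : formula -> atom) : base :=
  fun r =>
    (exists s t, inXi Gamma phi (Lolli s t) /\
       (r = ([:: ([:: flat s], flat t)], flat (Lolli s t)) \/
        r = ([:: ([::], flat (Lolli s t)); ([::], flat s)], flat t)))
    \/
    (exists s t, inXi Gamma phi (Tensor s t) /\
       (r = ([:: ([::], flat s); ([::], flat t)], flat (Tensor s t)) \/
        exists p : atom,
          r = ([:: ([::], flat (Tensor s t)); ([:: flat s; flat t], p)], p)))
    \/
    (inXi Gamma phi One /\
       (r = ([::], flat One) \/
        exists p : atom, r = ([:: ([::], flat One); ([::], p)], p))).

(* Main.v *)
Require Import Defs.
From mathcomp Require Import all_boot.

(* The base M adds, for every connective occurring in Xi, an introduction
   rule and an elimination rule on the flattened atoms.  Each clause of the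
   theorem is the atomic shadow of the corresponding natural-deduction
   equivalence, proved in two directions:
   - "only if": apply the elimination rule of M (for the tensor and the
     unit, in an arbitrary extension Y of B, using that derivability is
     monotone in the base);
   - "if": apply the introduction rule of M (for the tensor and the unit,
     instantiate the hypothesis with Y := B, V := [::] and p := the
     flattened formula, whose premise is obtained by that introduction). *)

Lemma deriv_mono (B C : base) :
  subbase B C -> forall S p, deriv B S p -> deriv C S p.
Proof.
move=> BC S p; elim=> [q | prem q Ss S' HB Hsize _ IH Hperm].
  exact: deriv_Ref.
exact: deriv_App (BC _ HB) Hsize IH Hperm.
Qed.

Lemma deriv_app0 (B : base) (q : atom) : B ([::], q) -> deriv B [::] q.
Proof. by move=> HB; apply: (@deriv_App B [::] q [::] [::] HB). Qed.

Lemma deriv_app1 (B : base) (P : amset) (p q : atom) (S : amset) :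
  B ([:: (P, p)], q) -> deriv B (S ++ P) p -> deriv B S q.
Proof.
move=> HB Hp; apply: (@deriv_App B _ q [:: S] S HB) => //.
  by case.
by rewrite /= cats0.
Qed.

Lemma deriv_app2 (B : base) (P1 : amset) (p1 : atom) (P2 : amset) (p2 q : atom)
    (S1 S2 S : amset) :
  B ([:: (P1, p1); (P2, p2)], q) ->
  deriv B (S1 ++ P1) p1 -> deriv B (S2 ++ P2) p2 ->
  perm_eq S (S1 ++ S2) -> deriv B S q.
Proof.
move=> HB H1 H2 Hperm; apply: (@deriv_App B _ q [:: S1; S2] S HB) => //.
  by case=> [|[|i]].
by rewrite /= cats0.
Qed.

Section RulesOfM.

Variables (Gamma : seq formula) (phi : formula) (flat : formula -> atom).
Variable B : base.
Hypothesis M_sub_B : subbase (Mbase Gamma phi flat) B.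

Local Notation inXi := (inXi Gamma phi).

Lemma lolli_intro_rule {s t : formula} :
  inXi (Lolli s t) -> B ([:: ([:: flat s], flat t)], flat (Lolli s t)).
Proof. by move=> Hx; apply: M_sub_B; left; exists s, t; split; [|left]. Qed.

Lemma lolli_elim_rule {s t : formula} :
  inXi (Lolli s t) ->
  B ([:: ([::], flat (Lolli s t)); ([::], flat s)], flat t).
Proof. by move=> Hx; apply: M_sub_B; left; exists s, t; split; [|right]. Qed.

Lemma tensor_intro_rule {s t : formula} :
  inXi (Tensor s t) ->
  B ([:: ([::], flat s); ([::], flat t)], flat (Tensor s t)).
Proof. by move=> Hx; apply: M_sub_B; right; left; exists s, t; split; [|left]. Qed.

Lemma tensor_elim_rule {s t : formula} (p : atom) :
  inXi (Tensor s t) ->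
  B ([:: ([::], flat (Tensor s t)); ([:: flat s; flat t], p)], p).
Proof.
by move=> Hx; apply: M_sub_B; right; left; exists s, t; split; [|right; exists p].
Qed.

Lemma one_intro_rule : inXi One -> B ([::], flat One).
Proof. by move=> Hx; apply: M_sub_B; right; right; split; [|left]. Qed.

Lemma one_elim_rule (p : atom) :
  inXi One -> B ([:: ([::], flat One); ([::], p)], p).
Proof. by move=> Hx; apply: M_sub_B; right; right; split; [|right; exists p]. Qed.

Lemma deriv_lolli_iff (S : amset) (s t : formula) :
  inXi (Lolli s t) ->
  deriv B S (flat (Lolli s t)) <-> deriv B (S ++ [:: flat s]) (flat t).
Proof.
move=> Hx; split=> H.
  apply: (deriv_app2 _ _ _ _ _ _ S [:: flat s] _ (lolli_elim_rule Hx)) => //.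
    by rewrite cats0.
  exact: deriv_Ref.
exact: deriv_app1 (lolli_intro_rule Hx) H.
Qed.

Lemma deriv_tensor_iff (S : amset) (s t : formula) :
  inXi (Tensor s t) ->
  deriv B S (flat (Tensor s t)) <->
  (forall (Y : base) (V : amset) (p : atom), subbase B Y ->
     deriv Y (V ++ [:: flat s; flat t]) p -> deriv Y (S ++ V) p).
Proof.
move=> Hx; split=> [H Y V p BY HV | H].
  apply: (deriv_app2 _ _ _ _ _ _ S V _ (BY _ (tensor_elim_rule p Hx))) => //.
  by rewrite cats0; exact: deriv_mono BY _ _ H.
have pair_deriv : deriv B [:: flat s; flat t] (flat (Tensor s t)).
  by apply: (deriv_app2 _ _ _ _ _ _ [:: flat s] [:: flat t] _
                        (tensor_intro_rule Hx)) => //; exact: deriv_Ref.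
by have := H B [::] _ (fun r h => h) pair_deriv; rewrite cats0.
Qed.

Lemma deriv_one_iff (S : amset) :
  inXi One ->
  deriv B S (flat One) <->
  (forall (Y : base) (V : amset) (p : atom), subbase B Y ->
     deriv Y V p -> deriv Y (S ++ V) p).
Proof.
move=> Hx; split=> [H Y V p BY HV | H].
  apply: (deriv_app2 _ _ _ _ _ _ S V _ (BY _ (one_elim_rule p Hx))) => //.
    by rewrite cats0; exact: deriv_mono BY _ _ H.
  by rewrite cats0.
have unit_deriv : deriv B [::] (flat One) by exact: deriv_app0 (one_intro_rule Hx).
by have := H B [::] _ (fun r h => h) unit_deriv; rewrite cats0.
Qed.

End RulesOfM.

Theorem mainTheorem13 (Gamma : seq formula) (phi : formula) (flat : formula -> atom) :
  flat_ok Gamma phi flat ->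
  forall (B : base), subbase (Mbase Gamma phi flat) B ->
  forall (S : amset),
    (forall s t, inXi Gamma phi (Lolli s t) ->
       (deriv B S (flat (Lolli s t)) <-> deriv B (S ++ [:: flat s]) (flat t))) /\
    (forall s t, inXi Gamma phi (Tensor s t) ->
       (deriv B S (flat (Tensor s t)) <->
        (forall (Y : base) (V : amset) (p : atom), subbase B Y ->
           deriv Y (V ++ [:: flat s; flat t]) p -> deriv Y (S ++ V) p))) /\
    (inXi Gamma phi One ->
       (deriv B S (flat One) <->
        (forall (Y : base) (V : amset) (p : atom), subbase B Y ->
           deriv Y V p -> deriv Y (S ++ V) p))).
Proof.
move=> _ B M_sub_B S; split; [|split].
- by move=> s t; exact: deriv_lolli_iff.
- by move=> s t; exact: deriv_tensor_iff.
- exact: deriv_one_iff.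
Qed.
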